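(* Let $\mathcal X\subset\mathbb R^n$, $\mathcal U\subset\mathbb R^m$, and let $f:\mathcal X\to\mathcal X$ and $\mu:\mathcal X\times\mathcal U\to\mathcal X$ be maps with $x\in\mu(x,\mathcal U)$ for all $x\in\mathcal X$. Let the sets $[x]_{-k}$, $[x]_{-k}^{-}$ ($k\in\mathbb N$) and $[x]_1^{-}$ be defined as in the context. Suppose that (1) there exists $p\ge 1$ such that $[x]_{1-p}=\mathcal X$ for all $x\in\mathcal X$; and (2) for all $x,\hat x\in\mathcal X$, $\hat x\in[x]_0$ implies $[\hat x]_0=[x]_0$. With $p$ as in (1), let $\pi(\hat x,x)$ be the largest $j\in\{2-p,\ldots,-1,0,1\}$ such that $[\hat x]_0\cap[x]_{j}^{-}\neq\emptyset$. Then the system $$\hat x^{+}\in f\big([\hat x]_0\cap[x]^{-}_{\pi(\hat x,x)}\big)$$ is a deadbeat tracker for the system $\hat x^+=f(\mu(\hat x,u))$.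
   Context: Setting: the controlled discrete-time system is $\hat x^{+}=f(\mu(\hat x,u))$ with state $\hat x\in\mathcal X$ and input $u\in\mathcal U$; $\hat x^+$ denotes the state at the next time instant. It is to track the autonomous system $x^{+}=f(x)$, whose solution is $\phi(k,x)$, with $\phi(0,x)=x$ and $\phi(k+1,x)=f(\phi(k,x))$. $\mathbb N$ is the set of nonnegative integers. Notation: $\mu(\mathcal S,\mathcal U)=\{\mu(s,u):s\in\mathcal S,u\in\mathcal U\}$ and $\mu(x,\mathcal U)=\mu(\{x\},\mathcal U)$; $f^{-1}(\mathcal S)=\{x\in\mathcal X: f(x)\in\mathcal S\}$ is the preimage ($f$ need not be bijective). Sets: for $x\in\mathcal X$, $[x]_0:=\mu(x,\mathcal U)$, and for $k=0,1,2,\ldots$, $[x]_{-k}^{-}:=f^{-1}([f(x)]_{-k})$ and $[x]_{-k-1}:=\mu([x]_{-k}^{-},\mathcal U)$. Also $[x]_1^{-}:=\{x\}$. Deadbeat feedback law and tracker: given a set-valued map $\kappa:\mathcal X\times\mathcal X\rightrightarrows\mathcal U$ with nonempty values, consider the coupled systems $x^{+}=f(x)$, $\hat x^{+}\in f(\mu(\hat x,\kappa(\hat x,x)))$, and let $\psi(k,\hat x,x)$ denote a solution of the second (there may be several) at time $k$ for initial conditions $(\hat x,x)$. The map $\kappa$ is a deadbeat feedback law for $\hat x^+=f(\mu(\hat x,u))$ if there exists $q\ge1$ such that all solutions satisfy $\psi(k,\hat x,x)=\phi(k,x)$ for all $x,\hat x\in\mathcal X$ and all $k\ge q$; the system $\hat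 x^{+}\in f(\mu(\hat x,\kappa(\hat x,x)))$ is then called a deadbeat tracker. The system in the claim is of this form with $\kappa(\hat x,x)=\{u\in\mathcal U:\mu(\hat x,u)\in[\hat x]_0\cap[x]^{-}_{\pi(\hat x,x)}\}$. *)

(* Defs.v *)
From mathcomp Require Import all_boot all_order all_algebra.
From mathcomp Require Import all_classical all_reals.
Set Implicit Arguments.
Unset Strict Implicit.
Unset Printing Implicit Defensive.
Import Order.TTheory GRing.Theory Num.Theory.
Local Open Scope classical_set_scope.
Local Open Scope ring_scope.

(* The state space T and the input space V are types here; subsets of R^n and
   R^m enter as the types of their elements (the coercion set_type).  This makes
   f @^-1` S the preimage within the state space. *)

Definition mu_image (T V : Type) (mu : T -> V -> T) (S : set T) : set T :=
  [set mu s u | s in S & u in [set: V]].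

(* back f mu k x is [x]_{-k}: mu(x, U) for k = 0, and mu([x]_{1-k}^-, U)
   with [x]_{1-k}^- = f^{-1}([f x]_{1-k}) for k >= 1. *)
Fixpoint back (T V : Type) (f : T -> T) (mu : T -> V -> T) (k : nat) (x : T)
    : set T :=
  if k is k'.+1 then mu_image mu (f @^-1` back f mu k' (f x))
  else mu_image mu [set x].

(* back_pre f mu j x is [x]_j^-, meaningful for j <= 1; the value set0 for
   j >= 2 is never used. *)
Definition back_pre (T V : Type) (f : T -> T) (mu : T -> V -> T)
    (j : int) (x : T) : set T :=
  if j == 1 then [set x]
  else if j <= 0 then f @^-1` back f mu `|j|%N (f x)
  else set0.

Definition meeting_indices (T V : Type) (f : T -> T) (mu : T -> V -> T)
    (p : nat) (xh x : T) : set int :=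
  [set j | 2 - p%:Z <= j <= 1 /\ back f mu 0 xh `&` back_pre f mu j x !=set0].

(* The largest element of meeting_indices.  If there were none, the value would
   be the default 1 and back f mu 0 xh `&` back_pre f mu 1 x would be empty
   (when p >= 1), contradicting the nonemptiness required of the feedback in
   deadbeat_feedback_law; so the default cannot mask an undefined maximum. *)
Definition max_index (T V : Type) (f : T -> T) (mu : T -> V -> T)
    (p : nat) (xh x : T) : int :=
  xget 1 (meeting_indices f mu p xh x `&` ubound (meeting_indices f mu p xh x)).

Definition target (T V : Type) (f : T -> T) (mu : T -> V -> T)
    (p : nat) (xh x : T) : set T :=
  back f mu 0 xh `&` back_pre f mu (max_index f mu p xh x) x.

Definition phi (T : Type) (f : T -> T) (k : nat) (x : T) : T := iter k f x.

Definition closed_loop (T V : Type) (f : T -> T) (mu : T -> V -> T)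
    (kappa : T -> T -> set V) (xh x : T) : set T :=
  f @` (mu xh @` kappa xh x).

Definition tracker_solution (T V : Type) (f : T -> T) (mu : T -> V -> T)
    (kappa : T -> T -> set V) (xh x : T) (psi : nat -> T) : Prop :=
  psi 0%N = xh /\
  forall k, closed_loop f mu kappa (psi k) (phi f k x) (psi k.+1).

Definition deadbeat_feedback_law (T V : Type) (f : T -> T) (mu : T -> V -> T)
    (kappa : T -> T -> set V) : Prop :=
  (forall xh x, kappa xh x !=set0) /\
  exists q : nat, (1 <= q)%N /\
    forall (xh x : T) (psi : nat -> T),
      tracker_solution f mu kappa xh x psi ->
      forall k, (q <= k)%N -> psi k = phi f k x.

Definition deadbeat_tracker (T V : Type) (f : T -> T) (mu : T -> V -> T)
    (kappa : T -> T -> set V) (F : T -> T -> set T) : Prop :=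
  deadbeat_feedback_law f mu kappa /\
  forall xh x, F xh x = closed_loop f mu kappa xh x.

(* Main.v *)
Require Import Defs.
From mathcomp Require Import all_boot all_order all_algebra.
From mathcomp Require Import all_classical all_reals.
From mathcomp Require Import zify.
Local Open Scope classical_set_scope.
Local Open Scope ring_scope.

(** The sets [x]_0 partition the state space, so xh lies in [x]_{-k} iff
    [xh]_0 meets [x]_{1-k}^-. Hence the feedback picks the least k with
    xh \in [x]_{-k}; if k > 0 the next pair of states satisfies the same
    membership with k - 1, and if k = 0 the tracker jumps onto the reference.
    Since k <= p - 1 initially, tracking is exact after p steps. *)

Section Tracking.
Set Implicit Arguments.
Unset Strict Implicit.
Context {T V : Type} (f : T -> T) (mu : T -> V -> T).
Hypothesis mu_refl : forall x, mu_image mu [set x] x.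
Hypothesis back0_eq : forall x xh,
  back f mu 0 x xh -> back f mu 0 xh = back f mu 0 x.

Lemma mu_imageE (S : set T) y :
  mu_image mu S y <-> exists2 s, S s & back f mu 0 s y.
Proof.
split=> [[s Ss [u _ <-]]|[s Ss [_ -> [u _ <-]]]].
  by exists s => //; exists s => //; exists u.
by exists s => //; exists u.
Qed.

(** By [back0_eq], both points have the same set [[.]_0], and that set contains [x] by [mu_refl]. *)
Lemma back0_sym x y : back f mu 0 x y -> back f mu 0 y x.
Proof. by move=> xy; rewrite (back0_eq xy); exact: mu_refl. Qed.

Lemma back_refl k x : back f mu k x x.
Proof.
elim: k x => [|k IHk] x; first exact: mu_refl.
by apply/mu_imageE; exists x; [exact: IHk|exact: mu_refl].
Qed.

(** At depth 0, [x] itself serves as the intermediate point, since [f x] lies in its own [[f x]_0];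
    deeper levels inherit the inclusion through preimage and [mu_image]. *)
Lemma backS k x : back f mu k x `<=` back f mu k.+1 x.
Proof.
elim: k x => [|k IHk] x y.
  by move=> xy; apply/mu_imageE; exists x => //; exact: mu_refl.
move=> /mu_imageE[s fs sy]; apply/mu_imageE; exists s => //.
exact: IHk fs.
Qed.

Lemma back_le k l x : (k <= l)%N -> back f mu k x `<=` back f mu l x.
Proof.
move=> /subnK <-; elim: (l - k)%N => [//|d IHd] y /IHd.
exact: backS.
Qed.

Lemma back_pre1 x : back_pre f mu (1 - 0%N%:Z) x = [set x].
Proof. by []. Qed.

Lemma back_preS k x :
  back_pre f mu (1 - k.+1%:Z) x = f @^-1` back f mu k (f x).
Proof.
rewrite /back_pre.
have -> : (1 - k.+1%:Z == 1) = false by lia.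
have -> : (1 - k.+1%:Z <= 0) by lia.
by have -> : `|1 - k.+1%:Z|%N = k by lia.
Qed.

Lemma back_meetsP k xh x :
  back f mu k x xh <->
  back f mu 0 xh `&` back_pre f mu (1 - k%:Z) x !=set0.
Proof.
case: k => [|k].
  rewrite back_pre1; split=> [/back0_sym xhx|[s [xhs sx]]].
    by exists x.
  by apply: back0_sym; rewrite -sx.
rewrite back_preS; split=> [/mu_imageE[s fs /back0_sym xhs]|[s [xhs fs]]].
  by exists s.
by apply/mu_imageE; exists s => //; exact: back0_sym.
Qed.

(** The substitution [j = 1 - k] reverses order, so the largest meeting index corresponds to the
    least depth [k]; the bound [p - 1] on the depth keeps [j] at or above [2 - p]. *)
Lemma max_indexP p xh x : (1 <= p)%N -> back f mu (p - 1) x xh ->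
  exists k, [/\ max_index f mu p xh x = 1 - k%:Z, back f mu k x xh &
    forall l, back f mu l x xh -> (k <= l)%N].
Proof.
move=> p_gt0 xhp.
have ex : exists k, `[< back f mu k x xh >] by exists (p - 1)%N; exact/asboolP.
have [k /asboolP xhk kmin] := ex_minnP ex.
have le_kp : (k <= p - 1)%N by apply: kmin; exact/asboolP.
have maxk : (meeting_indices f mu p xh x `&`
             ubound (meeting_indices f mu p xh x)) (1 - k%:Z).
  split; first by split; [lia|exact/back_meetsP].
  move=> j [jp jne].
  (* As [j <= 1], the difference [1 - j] is a natural number, the depth belonging to [j]. *)
  have jE : j = 1 - `|(1 - j)%R|%N%:Z by lia.
  rewrite jE in jne; move/back_meetsP/asboolP/kmin: jne; lia.
(* A maximum exists, so [xget] does not fall back on its default 1; two maxima bound each other and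
   hence coincide. *)
have [] := @xgetPex _ 1 _ (ex_intro _ _ maxk).
rewrite -/(max_index f mu p xh x) => -[jp jne] jub.
exists k; split=> // [|l /asboolP/kmin//].
have := jub _ maxk.1; have := maxk.2 _ (conj jp jne); lia.
Qed.

Lemma target_nonempty p xh x : (1 <= p)%N -> back f mu (p - 1) x xh ->
  target f mu p xh x !=set0.
Proof.
move=> p_gt0 /(max_indexP p_gt0)[k [jE /back_meetsP xhk _]].
by rewrite /target jE.
Qed.

Lemma target_back0 p xh x y : (1 <= p)%N -> back f mu 0 x xh ->
  target f mu p xh x y -> y = x.
Proof.
move=> p_gt0 xh0 [_].
have [|k [-> _ kmin]] := @max_indexP p xh x p_gt0; first exact: back_le xh0.
by have /eqP -> : k == 0%N by rewrite -leqn0; exact: kmin.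
Qed.

Lemma target_backS p k xh x y : (k.+1 < p)%N -> back f mu k.+1 x xh ->
  target f mu p xh x y -> back f mu k (f x) (f y).
Proof.
move=> lt_kp xhk [_].
have [| |[|l] [-> _ lmin]] := @max_indexP p xh x; first by lia.
- by apply: back_le xhk; lia.
(* Least depth 0: the target is [x] itself, and [f x] belongs to each of its own backward sets. *)
- by rewrite back_pre1 => ->; exact: back_refl.
(* Least depth [l.+1 <= k.+1]: the target gives depth [l] after applying [f], which monotonicity
   raises to [k]. *)
by rewrite back_preS; apply: back_le; exact: lmin xhk.
Qed.

(** Target points lie in [[xh]_0], so each is reached from [xh] by some input. *)
Lemma image_target p xh x :
  mu xh @` [set u | target f mu p xh x (mu xh u)] = target f mu p xh x.
Proof.
apply/seteqP; split=> [_ [u tu <-]//|y ty].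
by have [[_ -> [u _ uy]] _] := ty; exists u; rewrite //= uy.
Qed.

Lemma deadbeat_tracker_target p : (1 <= p)%N ->
  (forall x, back f mu (p - 1) x = [set: T]) ->
  deadbeat_tracker f mu
    (fun xh x => [set u | target f mu p xh x (mu xh u)])
    (fun xh x => f @` target f mu p xh x).
Proof.
move=> p_gt0 backT; split=> [|xh x]; last by rewrite /closed_loop image_target.
split=> [xh x|].
  have [|y] := @target_nonempty p xh x p_gt0; first by rewrite backT.
  by rewrite -{1}image_target => -[u tu _]; exists u.
(* The depth bound needs [p - 1] steps to fall from [p - 1] to 0, and one more step makes the states
   equal. *)
exists p; split=> // xh x psi [psi0 psiS].
have step i : exists2 y, target f mu p (psi i) (phi f i x) y & f y = psi i.+1.
  by have := psiS i; rewrite /closed_loop image_target => -[y]; exists y.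
have descent i : (i < p)%N -> back f mu (p - 1 - i) (phi f i x) (psi i).
  elim: i => [|i IHi] lt_ip; first by rewrite subn0 backT.
  have [y ty <-] := step i.
  have := IHi (ltnW lt_ip); have -> : (p - 1 - i = (p - 1 - i.+1).+1)%N by lia.
  by move=> xhi; apply: target_backS xhi ty; lia.
have jump i : back f mu 0 (phi f i x) (psi i) -> psi i.+1 = phi f i.+1 x.
  by have [y ty <-] := step i; move=> xhi; rewrite (target_back0 p_gt0 xhi ty).
move=> k /subnK <-; elim: (k - p)%N => [|d IHd].
  rewrite add0n -(prednK p_gt0); apply: jump.
  have := descent p.-1; have -> : (p - 1 - p.-1 = 0)%N by lia.
  by apply; lia.
(* Equal states are at depth 0, so equality persists by the same jump. *)
by apply: jump; rewrite IHd; exact: back_refl.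
Qed.

End Tracking.

Theorem theorem3 (R : realType) (n m : nat)
    (X : set 'rV[R]_n) (U : set 'rV[R]_m)
    (f : X -> X) (mu : X -> U -> X)
    (hmu : forall x : X, mu_image mu [set x] x)
    (p : nat) (hp : (1 <= p)%N)
    (h1 : forall x : X, back f mu (p - 1)%N x = [set: X])
    (h2 : forall x xh : X,
        back f mu 0%N x xh -> back f mu 0%N xh = back f mu 0%N x) :
  deadbeat_tracker f mu
    (fun xh x : X => [set u : U | target f mu p xh x (mu xh u)])
    (fun xh x : X => f @` target f mu p xh x).
Proof. exact: deadbeat_tracker_target. Qed.
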